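(* Let $I \subseteq \mathbb{3}^{X}$. Then $Ann^{2}(I) = I$ if and only if there exists $Y \subseteq X$ such that \begin{enumerate} \item[\rm(P1)] for all $\alpha \in I$, for all $y \in Y$, $\alpha(y) = U$; \item[\rm(P2)] for all $f : Y^{c} \rightarrow \mathbb{3}$ there exists $\alpha \in I$ such that $\alpha|_{Y^{c}} = f$. \end{enumerate}
   Context: $\mathbb{3} = \{T, F, U\}$ is McCarthy's three-valued logic: $\neg T = F$, $\neg F = T$, $\neg U = U$; $T \wedge y = y$, $F \wedge y = F$, $U \wedge y = U$; $T \vee y = T$, $F \vee y = y$, $U \vee y = U$. For a set $X$, $\mathbb{3}^{X}$ carries the pointwise operations, with constant ${\bf U}$ the function identically $U$. For $a \in \mathbb{3}^X$, $Ann(a) = \{ \alpha \in \mathbb{3}^X : (\alpha \wedge a) \vee (\neg \alpha \wedge a) = {\bf U} \}$, and for $S \subseteq \mathbb{3}^X$, $Ann(S) = \bigcap_{a \in S} Ann(a)$; $Ann^2 = Ann \circ Ann$. *)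

(* Defs.v *)
From mathcomp Require Import all_boot.
From mathcomp Require Import boolp classical_sets functions.

Set Implicit Arguments.
Unset Strict Implicit.
Unset Printing Implicit Defensive.

Local Open Scope classical_set_scope.

Inductive three : Type := T3 | F3 | U3.

Definition neg3 (x : three) : three :=
  match x with T3 => F3 | F3 => T3 | U3 => U3 end.

(* McCarthy's connectives are evaluated from left to right, hence not
   commutative: the second argument matters only if the first does not
   already decide the result. *)
Definition and3 (x y : three) : three :=
  match x with T3 => y | F3 => F3 | U3 => U3 end.

Definition or3 (x y : three) : three :=
  match x with T3 => T3 | F3 => y | U3 => U3 end.

Section Pointwise.
Context {X : Type}.
Implicit Types a b : X -> three.

Definition f_neg a : X -> three := fun x => neg3 (a x).
Definition f_and a b : X -> three := fun x => and3 (a x) (b x).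
Definition f_or a b : X -> three := fun x => or3 (a x) (b x).
Definition f_U : X -> three := fun=> U3.

Definition Ann1 a : set (X -> three) :=
  [set alpha | f_or (f_and alpha a) (f_and (f_neg alpha) a) = f_U].

(* The empty intersection is the whole space: Ann set0 = setT. *)
Definition Ann (S : set (X -> three)) : set (X -> three) :=
  \bigcap_(a in S) Ann1 a.

End Pointwise.

(* Main.v *)
(** At each point, [alpha] annihilates [a] iff [alpha] or [a] takes the value
    [U] there.  Hence [Ann S] only depends on the set [Y] of common [U]-points
    of [S]: it consists of all functions that are [U] off [Y].  Its own set of
    common [U]-points is the complement of [Y], so [Ann (Ann S)] consists of
    all functions that are [U] on [Y]. *)

Require Import Defs.
From mathcomp Require Import all_boot.
From mathcomp Require Import boolp classical_sets functions.

Local Open Scope classical_set_scope.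

Definition common_U {X : Type} (S : set (X -> three)) : set X :=
  [set x | forall a, S a -> a x = U3].

(** Where [alpha] is T or F, one of the two conjunctions is [a] and the other F, so their
    disjunction is [a]; where [alpha] is U, so is the disjunction. *)
Lemma Ann1P (X : Type) (a alpha : X -> three) :
  Ann1 a alpha <-> forall x, alpha x = U3 \/ a x = U3.
Proof.
split=> [/(congr1 (fun g => g _)) + x | h].
  by move=> /(_ x); rewrite /f_or /f_and /f_neg /f_U;
    case: (alpha x); case: (a x); auto.
apply/funext => x; rewrite /f_or /f_and /f_neg /f_U.
by case: (h x) => ->; case: (alpha x).
Qed.

Lemma AnnE (X : Type) (S : set (X -> three)) :
  Ann S = [set alpha | forall x, ~ common_U S x -> alpha x = U3].
Proof.
apply/seteqP; split=> alpha /= h.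
  move=> x /existsNP[a /not_implyP[Sa ax]].
  by case: ((Ann1P _ _ _).1 (h a Sa) x).
move=> a Sa; apply/Ann1P => x.
by have [Ux|Ux] := pselect (common_U S x); [right; exact: Ux | left; exact: h].
Qed.

Lemma common_U_Ann (X : Type) (S : set (X -> three)) :
  common_U (Ann S) = ~` common_U S.
Proof.
rewrite AnnE; apply/seteqP; split=> x /= h; last by move=> a; apply.
(* This [a] is U off [common_U S], so it lies in [Ann S], but it is T at [x], against [h]. *)
move=> Ux; pose a y := if pselect (common_U S y) then T3 else U3.
suff /h : forall y, ~ common_U S y -> a y = U3 by rewrite /a; case: pselect.
by move=> y nUy; rewrite /a; case: pselect.
Qed.

Lemma Ann_AnnE (X : Type) (S : set (X -> three)) :
  Ann (Ann S) = [set alpha | forall x, common_U S x -> alpha x = U3].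
Proof.
by rewrite AnnE common_U_Ann; apply/seteqP; split=> alpha /= h x Ux;
  apply: h => //; apply: contrapT.
Qed.

Theorem theorem4p10 (X : Type) (I : set (X -> three)) :
  Ann (Ann I) = I <->
  exists Y : set X,
    (forall alpha : X -> three, I alpha -> forall y : X, Y y -> alpha y = U3) /\
    (forall f : ~` Y -> three,
        exists alpha : X -> three, I alpha /\ sigL (~` Y) alpha = f).
Proof.
rewrite Ann_AnnE; split=> [IE | [Y [IY Iext]]].
  exists (common_U I); split=> [alpha Ia y|f]; first exact.
  exists ('valL_U3 f); split; last exact: valLK.
  (* Writing [f] as the restriction of its own extension exposes a [patch], whose value off its
     domain is the default U. *)
  rewrite -[X in X _]IE => x Ux; rewrite -[f](valLK U3).
  have /(congr1 (fun g => g ('valL_U3 f) x)) /= -> :=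
    sigLK U3 (A := ~` common_U I).
  by rewrite patchC // inE /= notK.
have UI : common_U I = Y.
  apply/seteqP; split=> [x Ux|y Yy alpha Ia]; last exact: IY Ia y Yy.
  apply: contrapT => nYx; have xYC : x \in ~` Y by rewrite inE.
  (* Extending a function without U values gives a member of [I] that is T at [x], against [Ux]. *)
  have [alpha [Ia alphaT]] := Iext (fun=> T3).
  by have := sigLE (~` Y) alpha x xYC; rewrite alphaT (Ux _ Ia).
rewrite UI; apply/seteqP; split=> [alpha aU|alpha Ia x]; last exact: IY.
(* This [beta] in [I] agrees with [alpha] off [Y], and on [Y] both are U. *)
have [beta [Ib /eq_sigLP eq_ba]] := Iext (sigL (~` Y) alpha).
suff -> : alpha = beta by [].
apply/funext => x; have [Yx|nYx] := pselect (Y x).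
  by rewrite (aU x Yx) (IY _ Ib x Yx).
by rewrite eq_ba // inE.
Qed.
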